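(* Let $Q$ be a commutative A-loop of exponent $2$ (i.e. $x^2=1$ for all $x\in Q$). Define on $Q$ the operation $x\oplus y = \big( ((xy)\backslash x)\cdot((yx)\backslash y)\big)^{-1}$. Then $(Q,\oplus)$ is an elementary abelian $2$-group.
   Context: A loop is a set with a binary operation and neutral element $1$ in which all left and right translations $L_x:y\mapsto xy$, $R_x:y\mapsto yx$ are bijections; $\mathrm{Inn}(Q)$ is the stabilizer of $1$ in the group generated by all translations. A commutative A-loop is a commutative loop all of whose inner mappings are automorphisms. Left division: $x\backslash y$ is the unique $z$ with $xz=y$; $x^{-1}=x\backslash 1$. (In exponent $2$, $x\oplus y = x\backslash((xy)\backslash x)$.) *)

(* Defs.v *)
(* A loop, given equationally: multiplication, neutral element 1 and the two
   divisions.  The division axioms say exactly that every left translation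
   L_x : y |-> x*y and right translation R_x : y |-> y*x is a bijection, with
   inverses y |-> x \ y and y |-> y / x respectively. *)
Record loop := Loop {
  carrier :> Type;
  lmul : carrier -> carrier -> carrier;
  lone : carrier;
  lldiv : carrier -> carrier -> carrier;
  lrdiv : carrier -> carrier -> carrier;
  lmul1x : forall x, lmul lone x = x;
  lmulx1 : forall x, lmul x lone = x;
  lmul_ldiv : forall x y, lmul x (lldiv x y) = y;
  lldiv_mul : forall x y, lldiv x (lmul x y) = y;
  lmul_rdiv : forall x y, lmul (lrdiv y x) x = y;
  lrdiv_mul : forall x y, lrdiv (lmul y x) x = y
}.

Arguments lmul {l}.
Arguments lone {l}.
Arguments lldiv {l}.
Arguments lrdiv {l}.

Definition linv {Q : loop} (x : Q) : Q := lldiv x lone.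

(* Mlt(Q): the group generated by all translations L_x, R_x.  Its elements
   are exactly the finite compositions of translations and their inverses. *)
Inductive in_Mlt (Q : loop) : (Q -> Q) -> Prop :=
  | Mlt_id : in_Mlt Q (fun y => y)
  | Mlt_L : forall x f, in_Mlt Q f -> in_Mlt Q (fun y => lmul x (f y))
  | Mlt_Linv : forall x f, in_Mlt Q f -> in_Mlt Q (fun y => lldiv x (f y))
  | Mlt_R : forall x f, in_Mlt Q f -> in_Mlt Q (fun y => lmul (f y) x)
  | Mlt_Rinv : forall x f, in_Mlt Q f -> in_Mlt Q (fun y => lrdiv (f y) x).

Definition inner_mapping (Q : loop) (f : Q -> Q) : Prop :=
  in_Mlt Q f /\ f lone = lone.

Definition commutative_loop (Q : loop) : Prop :=
  forall x y : Q, lmul x y = lmul y x.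

(* A-loop: every inner mapping is an automorphism (inner mappings are
   bijections, so it remains to be multiplicative). *)
Definition A_loop (Q : loop) : Prop :=
  forall f, inner_mapping Q f -> forall x y : Q, f (lmul x y) = lmul (f x) (f y).

Definition exponent2 (Q : loop) : Prop := forall x : Q, lmul x x = lone.

Definition oplus {Q : loop} (x y : Q) : Q :=
  linv (lmul (lldiv (lmul x y) x) (lldiv (lmul y x) y)).

(* (G, op) is an elementary abelian 2-group: an associative, commutative
   operation with a neutral element e, in which every element squares to e
   (so every element is its own inverse). *)
Definition elementary_abelian_2group {G : Type} (op : G -> G -> G) : Prop :=
  (forall x y z, op x (op y z) = op (op x y) z) /\
  (forall x y, op x y = op y x) /\
  exists e : G, (forall x, op e x = x /\ op x e = x) /\ (forall x, op x x = e).

(* Main.v *)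
(** A commutative A-loop of exponent 2 carries the ternary operation
    [xyz] = y \ ((yx)(yz)), the product of the isotope with neutral
    element y.  It is totally symmetric, satisfies [xxy] = y and [1xy] = xy, and
    every map [uv-] is an automorphism of it.  Moreover x (+) y is the unique
    solution g of [xyg] = 1.  Call {x,y,z} a line at t when [xyz] = t.
    Associativity of (+) is then the Pasch configuration for the lines at 1: if
    {b,c,d}, {a,d,e} and {a,b,f} are lines, then so is {c,e,f}.  For a line
    {p,q,r} at t the translations P = [qr-], Q = [pr-], R = [pq-] and P' = [tp-],
    Q' = [tq-], R' = [tr-] satisfy P' = R P R^-1 = Q P Q^-1 and its analogues,
    and Pasch follows from these relations. *)

From Corelib Require Import ssreflect.
Require Import Defs.

(** All that the Pasch argument uses of [[xyz]]; [x + y + z] in an elementary abelian 2-group is an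
    instance. *)
Record symmetric_distributive {T : Type} (m : T -> T -> T -> T) : Prop := {
  tri_swap12 : forall x y z, m x y z = m y x z;
  tri_swap23 : forall x y z, m x y z = m x z y;
  tri_idem : forall x y, m x x y = y;
  tri_distr : forall u v x y z,
    m u v (m x y z) = m (m u v x) (m u v y) (m u v z);
  tri_inj : forall x y z z', m x y z = m x y z' -> z = z';
  tri_surj : forall x y z, exists z', m x y z' = z
}.

Section Ternary.

Context {T : Type} {m : T -> T -> T -> T} (Hm : symmetric_distributive m).

Lemma tri_swap13 x y z : m x y z = m z y x.
Proof. by rewrite (tri_swap12 _ Hm) (tri_swap23 _ Hm) (tri_swap12 _ Hm). Qed.

Lemma tri_rot x y z : m x y z = m y z x.
Proof. by rewrite (tri_swap12 _ Hm) (tri_swap23 _ Hm). Qed.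

Lemma tri_swapped_idem x y : m x y y = x.
Proof. by rewrite tri_swap13 (tri_idem _ Hm). Qed.

(* P' R = R P *)
Lemma line_conj p q r t x :
  m p q r = t -> m t p (m p q x) = m p q (m q r x).
Proof.
move=> E; rewrite (tri_distr _ Hm p q q r x) E tri_swapped_idem.
by rewrite (tri_swap12 _ Hm).
Qed.

(* R commutes with P^-1 Q *)
Lemma line_comm p q r t x y :
  m p q r = t -> m q r y = m p r x -> m q r (m p q y) = m p r (m p q x).
Proof.
move=> E Exy.
have E1 : m r q p = t by rewrite tri_swap13.
have E2 : m r p q = t by rewrite tri_rot.
(* Conjugation turns P R into R' P and Q R into R' Q. *)
rewrite (tri_swap12 _ Hm q r) (tri_swap12 _ Hm p q y) -(line_conj _ _ _ _ _ E1).
rewrite (tri_swap12 _ Hm p r) -(line_conj _ _ _ _ _ E2).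
by rewrite (tri_swap12 _ Hm r q) (tri_swap12 _ Hm r p) Exy.
Qed.

(* P'^-1 Q' = P^-1 Q *)
Lemma line_base p q r t x y :
  m p q r = t -> m q r y = m p r x -> m t p y = m t q x.
Proof.
move=> E Exy.
(* With x = R x' and y' = P^-1 Q x', commutation gives y = R y'; then P' R = R P and Q' R = R Q
   finish. *)
have [x' Ex] := tri_surj _ Hm p q x.
have [y' Ey] := tri_surj _ Hm q r (m p r x').
have Ry : m p q y' = y.
  by apply: (tri_inj _ Hm q r); rewrite (line_comm _ _ _ _ _ _ E Ey) Ex Exy.
have E' : m q p r = t by rewrite (tri_swap12 _ Hm).
rewrite -Ry (line_conj _ _ _ _ _ E) Ey -Ex (tri_swap12 _ Hm p q x').
by rewrite (line_conj _ _ _ _ _ E') (tri_swap12 _ Hm p q).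
Qed.

Lemma line_base_inv p q r t x y :
  m p q r = t -> m t p y = m t q x -> m q r y = m p r x.
Proof.
move=> E Exy; have [y1 Ey1] := tri_surj _ Hm q r (m p r x).
have E1 := line_base _ _ _ _ _ _ E Ey1.
by rewrite -Ey1; congr (m q r _); apply: (tri_inj _ Hm t p); rewrite E1.
Qed.

(* R commutes with P'^-1 Q' *)
Lemma line_base_comm p q r t x y :
  m p q r = t -> m t p y = m t q x -> m t p (m p q y) = m t q (m p q x).
Proof.
move=> E Exy; apply: (line_base _ _ _ _ _ _ E); apply: (line_comm _ _ _ _ _ _ E).
exact: line_base_inv E Exy.
Qed.

(* P' P^-1 = Q Q'^-1 *)
Lemma line_cross p q r t x y :
  m p q r = t -> m q r y = m t q x -> m t p y = m p r x.
Proof.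
(* For y = Q w, Q' x = P Q w = Q' P w gives x = P w, and P' Q = Q P finishes. *)
move=> E Exy; have [w Ew] := tri_surj _ Hm p r y.
have E1 : m q r p = t by rewrite -tri_rot.
have E2 : m p r q = t by rewrite (tri_swap23 _ Hm).
have Ex : x = m q r w.
  apply: (tri_inj _ Hm t q); rewrite -Exy -Ew (tri_swap12 _ Hm p r).
  by rewrite -(line_conj _ _ _ _ _ E1).
by rewrite Ex -Ew (line_conj _ _ _ _ _ E2) (tri_swap12 _ Hm r q).
Qed.

(** If [g] completes [c], [e] to a line, then [f = g] once {g,b,a} is a line. Applying [[ce-]]
    reduces this to [Ece], and [Ekey] moves [Ece] under [[bc-]]. *)
Lemma pasch a b c d e f t :
  m b c d = t -> m a d e = t -> m a b f = t -> m c e f = t.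
Proof.
move=> Hbcd Hade Habf.
have [u Eu] := tri_surj _ Hm a e b.
have Haed : m a e d = t by rewrite (tri_swap23 _ Hm).
have Hdae : m d a e = t by rewrite (tri_swap12 _ Hm).
have Hdea : m d e a = t by rewrite -tri_rot.
have Hbaf : m b a f = t by rewrite (tri_swap12 _ Hm).
have Hbdc : m b d c = t by rewrite (tri_swap23 _ Hm).
have Hdbc : m d b c = t by rewrite tri_rot.
have Hcbd : m c b d = t by rewrite (tri_swap12 _ Hm).
have Es : m a e (m b d u) = m t b (m a b e).
  by rewrite (tri_distr _ Hm) Eu Haed (tri_rot (m a e b)) (tri_swap23 _ Hm a e b).
have Esu : m b d u = m e f u.
  apply: (tri_inj _ Hm a e); rewrite Es (tri_distr _ Hm a e) Eu tri_swapped_idem.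
  rewrite (tri_swap12 _ Hm a b e) (line_conj _ _ _ _ _ Hbaf).
  by rewrite (tri_swap23 _ Hm a e f) (tri_rot b a).
have Ekey : m b c u = m c e a.
  (* Since [m t b e = m t e b], this one [x] serves both lines through [a]: {a,b,f} and {a,e,d}. *)
  have [x Ex] := tri_surj _ Hm t a (m t b e).
  have Ex1 := line_base_comm _ _ _ _ _ _ Habf Ex.
  have Ex2 : m e d x = m a d b.
    by apply: (line_base_inv _ _ _ _ _ _ Haed); rewrite Ex (tri_swap23 _ Hm).
  have Es1 : m a e (m b d u) = m t a (m a b x) by rewrite Es Ex1.
  have Es2 := line_cross _ _ _ _ _ _ Hdae Es1.
  apply: (tri_inj _ Hm b d).
  rewrite (tri_swap12 _ Hm b d) -(line_conj _ _ _ _ _ Hdbc).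
  rewrite (tri_swap12 _ Hm d b) Es2 (tri_distr _ Hm d e) (tri_distr _ Hm b d) Hdea Hbdc.
  rewrite (tri_swap12 _ Hm d e x) Ex2.
  by rewrite (tri_swap13 a d b) (tri_rot d e b) (tri_rot e b d).
have Ece : m t (m b c e) (m c e a) = m t c e.
  have [e0 Ee0] := tri_surj _ Hm b c e.
  have Eg : m d e u = m d b e0.
    apply: (tri_inj _ Hm t d).
    rewrite (line_conj _ _ _ _ _ Hdea) (line_conj _ _ _ _ _ Hdbc) Ee0.
    by rewrite (tri_swap12 _ Hm e a) Eu (tri_swap23 _ Hm).
  rewrite -Ekey -{1}Hbcd -(tri_distr _ Hm) Eg (tri_swap12 _ Hm b c).
  rewrite (tri_swap12 _ Hm d b) -(line_conj _ _ _ _ _ Hcbd).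
  by rewrite (tri_swap12 _ Hm c b) Ee0.
have [g Eg] := tri_surj _ Hm c e t.
have Hg : m g b a = t.
  apply: (tri_inj _ Hm c e); rewrite (tri_distr _ Hm) Eg (tri_swap23 _ Hm c e b).
  by rewrite (tri_swap12 _ Hm c b) Ece tri_rot.
suff -> : f = g by [].
by apply: (tri_inj _ Hm a b); rewrite Habf tri_swap13.
Qed.

End Ternary.

Definition tri {Q : loop} (x y z : Q) : Q :=
  lldiv y (lmul (lmul y x) (lmul y z)).

Lemma lmul_inj (Q : loop) (x y z : Q) : lmul x y = lmul x z -> y = z.
Proof. by move=> E; rewrite -(lldiv_mul Q x y) E lldiv_mul. Qed.

Lemma tri_1 (Q : loop) (x y : Q) : tri lone x y = lmul x y.
Proof. by rewrite /tri lmulx1 lldiv_mul. Qed.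

Section ExponentTwo.

Context {Q : loop} (HC : commutative_loop Q) (HA : A_loop Q) (HE : exponent2 Q).

Lemma lldivx1 (x : Q) : lldiv x lone = x.
Proof. by apply: (lmul_inj Q x); rewrite lmul_ldiv HE. Qed.

Lemma lldivxx (x : Q) : lldiv x x = lone.
Proof. by apply: (lmul_inj Q x); rewrite lmul_ldiv lmulx1. Qed.

(* The map z |-> xy \ (x (y \ z)) is inner and fixes xy, so it commutes with
   multiplication by xy. *)
Lemma tri_comm12 (x y z : Q) : tri x y z = tri y x z.
Proof.
rewrite /tri (HC x y); set w := lmul y x.
have Hg : inner_mapping Q (fun v => lldiv w (lmul x (lldiv y v))).
  split; first by apply: Mlt_Linv; apply: Mlt_L; apply: Mlt_Linv; apply: Mlt_id.
  by rewrite lldivx1 HC lldivxx.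
have := HA _ Hg w (lmul y z); rewrite /w !lldiv_mul HE lldivx1 lmul_ldiv -/w => E.
by apply: (lmul_inj Q x); rewrite [RHS]lmul_ldiv -E lmul_ldiv.
Qed.

Lemma tri_comm23 (x y z : Q) : tri x y z = tri x z y.
Proof.
have tri_comm13 u v w : @tri Q u v w = tri w v u by rewrite /tri HC.
by rewrite tri_comm12 tri_comm13 tri_comm12.
Qed.

(** The map v |-> (uy)(u(y \ v)) sends 1 to (uy)(uy) = 1, so it is an automorphism; evaluate it at
    (yx)(yz). *)
Lemma lmul_tri (u x y z : Q) :
  lmul u (tri x y z) = tri (lmul u x) (lmul u y) (lmul u z).
Proof.
have Hh : inner_mapping Q (fun v => lmul (lmul u y) (lmul u (lldiv y v))).
  split; first by apply: Mlt_L; apply: Mlt_L; apply: Mlt_Linv; apply: Mlt_id.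
  by rewrite lldivx1 HE.
have := HA _ Hh (lmul y x) (lmul y z); rewrite !lldiv_mul => E.
by apply: (lmul_inj Q (lmul u y)); rewrite [RHS]lmul_ldiv -E.
Qed.

Lemma lldiv_tri (u x y z : Q) :
  lldiv u (tri x y z) = tri (lldiv u x) (lldiv u y) (lldiv u z).
Proof. by apply: (lmul_inj Q u); rewrite lmul_tri !lmul_ldiv. Qed.

Lemma tri_symmetric_distributive : symmetric_distributive (@tri Q).
Proof.
split.
- exact: tri_comm12.
- exact: tri_comm23.
- by move=> x y; rewrite /tri HE lmul1x lldiv_mul.
(* [[uv-]] is composed of L_v, L_{vu} and the inverse of L_v, each preserving [tri]. *)
- move=> u v x y z; rewrite {1}/tri lmul_tri lmul_tri lldiv_tri.
  by rewrite -![lldiv v (lmul (lmul v u) _)]/(tri u v _).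
- move=> x y z z' E; apply: (lmul_inj Q y); apply: (lmul_inj Q (lmul y x)).
  by rewrite -(lmul_ldiv Q y (lmul _ (lmul y z))) [lldiv _ _]E lmul_ldiv.
- move=> x y z; exists (lldiv y (lldiv (lmul y x) (lmul y z))).
  by rewrite /tri !lmul_ldiv lldiv_mul.
Qed.

Lemma line_mul (p q w : Q) :
  tri p q w = lone -> tri (lmul w p) (lmul w q) (lmul p q) = lone.
Proof.
move=> E.
(* Multiply the line by [x]: the first entry becomes 1, and [[1uv] = uv]. *)
have mul_line (x y z : Q) : tri x y z = lone -> lmul (lmul x y) (lmul x z) = x.
  by move=> Exyz; rewrite -tri_1 -{1}(HE x) -lmul_tri Exyz lmulx1.
have E' : tri q p w = lone by rewrite tri_comm12.
rewrite tri_comm23 /tri (HC w p) (HC w q) (mul_line _ _ _ E).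
by rewrite (HC p q) (mul_line _ _ _ E') HC lldivxx.
Qed.

Lemma tri_oplus (x y : Q) : tri x y (oplus x y) = lone.
Proof.
rewrite /oplus /linv lldivx1 (HC y x); set w := lmul x y.
(* [line_mul] carries this line to {x, y, (w \ x)(w \ y)}. *)
have E : tri (lldiv w x) (lldiv w y) w = lone.
  by rewrite tri_comm23 /tri !lmul_ldiv lldivxx.
by have := line_mul _ _ _ E; rewrite !lmul_ldiv.
Qed.

Lemma oplus_unique (x y g : Q) : tri x y g = lone -> oplus x y = g.
Proof.
by move=> E; apply: (tri_inj _ tri_symmetric_distributive x y); rewrite tri_oplus E.
Qed.

End ExponentTwo.

Theorem theorem6p2 (Q : loop) :
  commutative_loop Q -> A_loop Q -> exponent2 Q ->
  elementary_abelian_2group (@oplus Q).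
Proof.
move=> HC HA HE; have HT := tri_symmetric_distributive HC HA HE.
have comm : forall x y : Q, oplus x y = oplus y x.
  by move=> x y; apply: oplus_unique => //; rewrite (tri_swap12 _ HT) tri_oplus.
split; [|split=> //].
- move=> x y z; symmetry; apply: oplus_unique => //.
  (* Pasch with a, b, c = x, y, z: the sums y+z, x+(y+z) and x+y are d, e and f. *)
  have := pasch HT _ _ _ _ _ _ _ (tri_oplus HC HA HE y z)
    (tri_oplus HC HA HE x (oplus y z)) (tri_oplus HC HA HE x y).
  by rewrite -(tri_rot HT).
- have e1 x : @oplus Q lone x = x.
    by apply: oplus_unique => //; rewrite tri_1 HE.
  exists lone; split=> x; first by rewrite (comm x) e1.
  by apply: oplus_unique => //; rewrite (tri_idem _ HT).
Qed.
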